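(* Let $(A,+,\cdot)$ be a left nilpotent pre-Lie ring of cardinality $p^n$, where $p$ is a prime with $p\ge n+2$. Let $\Omega:A\to A$ be the inverse of the bijection $W$, and define $a\circ b=a+e^{L_{\Omega(a)}}(b)$ (the group of flows). Then $(A,+,\circ)$ is a left brace, and it is left nilpotent.
   Context: A (left) brace is a set $A$ with binary operations $+,\circ$ such that $(A,+)$ is an abelian group, $(A,\circ)$ is a group, and $a\circ(b+c)+a=a\circ b+a\circ c$ for all $a,b,c$; with $a*b=a\circ b-a-b$, it is left nilpotent if $A^m=0$ for some $m$, where $A^1=A$ and $A^{i+1}$ is the additive subgroup generated by $a*b$ ($a\in A,b\in A^i$). A pre-Lie ring is an abelian group $(A,+)$ with a biadditive product $\cdot$ satisfying $(x\cdot y)\cdot z-x\cdot(y\cdot z)=(y\cdot x)\cdot z-y\cdot(x\cdot z)$; left nilpotency is defined as for braces with $\cdot$ in place of $*$. Let $A^{\mathrm{id}}=A\times\mathbb Z$ with $(r,m)+(s,m')=(r+s,m+m')$, $(r,m)\cdot(s,m')=(r\cdot s+ms+m'r,mm')$; identify $A$ with $A\times\{0\}$, put $1=(0,1)$. For $a\in A$ let $L_a(x)=a\cdot x$ and $e^{L_a}(x)=\sum_{j\ge 0}\frac{1}{j!}L_a^j(x)$ for $x\in A^{\mathrm{id}}$ (finite sum since $A^{n+1}=0$; the needed factorials are invertible modulo $p^n$). Let $W(a)=e^{L_a}(1)-1\in A$; $W:A\to A$ is a bijection. *)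

(* Defs.v *)
From HB Require Import structures.
From mathcomp Require Import all_boot all_order all_algebra.
Set Implicit Arguments. Unset Strict Implicit. Unset Printing Implicit Defensive.
Import Order.TTheory GRing.Theory Num.Theory.
Local Open Scope ring_scope.

Definition add_gen (A : zmodType) (S : A -> Prop) : A -> Prop :=
  fun x => forall H : A -> Prop,
    H 0 -> (forall y z, H y -> H z -> H (y - z)) ->
    (forall y, S y -> H y) -> H x.

(* left powers: lpow op i = A^(i+1), with A^1 = A and
   A^(i+1) = additive subgroup generated by { op a b | a in A, b in A^i } *)
Fixpoint lpow (A : zmodType) (op : A -> A -> A) (i : nat) : A -> Prop :=
  match i with
  | 0 => fun _ => True
  | i'.+1 => add_gen (fun x => exists a b, lpow op i' b /\ x = op a b)
  end.

Definition left_nilpotent (A : zmodType) (op : A -> A -> A) : Prop :=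
  exists m : nat, forall x, lpow op m x -> x = 0.

Definition is_preLie_ring (A : zmodType) (mul : A -> A -> A) : Prop :=
  [/\ forall x y z, mul (x + y) z = mul x z + mul y z,
      forall x y z, mul x (y + z) = mul x y + mul x z &
      forall x y z, mul (mul x y) z - mul x (mul y z)
                    = mul (mul y x) z - mul y (mul x z)].

Definition is_group (A : Type) (op : A -> A -> A) : Prop :=
  associative op /\
  exists e : A, left_id e op /\ right_id e op /\
    forall a, exists b, op a b = e /\ op b a = e.

Definition is_left_brace (A : zmodType) (circ : A -> A -> A) : Prop :=
  is_group circ /\
  forall a b c, circ a (b + c) + a = circ a b + circ a c.

Definition brace_star (A : zmodType) (circ : A -> A -> A) (a b : A) : A :=
  circ a b - a - b.

(* (1/m) x in a finite abelian group: the y with m*y = x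
   (unique when m is coprime to #|A|) *)
Definition divA (A : finZmodType) (m : nat) (x : A) : A :=
  odflt 0 [pick y | y *+ m == x].

Definition idmul (A : zmodType) (mul : A -> A -> A) (x y : A * int) : A * int :=
  (mul x.1 y.1 + y.1 *~ x.2 + x.1 *~ y.2, x.2 * y.2).

Definition Lid (A : zmodType) (mul : A -> A -> A) (a : A) (x : A * int) : A * int :=
  idmul mul (a, 0) x.

(* e^{L_a}(x) = sum_{j=0}^{n} (1/j!) L_a^j(x)  (the terms j > n vanish since
   A^{n+1} = 0).  For j >= 1, L_a^j(x) lies in A x {0}, so (1/j!) is applied
   to its A-component. *)
Definition expL (A : finZmodType) (mul : A -> A -> A) (n : nat) (a : A)
    (x : A * int) : A * int :=
  x + \sum_(1 <= j < n.+1) (divA j`! (iter j (Lid mul a) x).1, 0%:Z).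

Definition Wmap (A : finZmodType) (mul : A -> A -> A) (n : nat) (a : A) : A :=
  (expL mul n a (0, 1%:Z) - (0, 1%:Z)).1.

Definition Omega (A : finZmodType) (mul : A -> A -> A) (n : nat) (b : A) : A :=
  odflt 0 [pick a | Wmap mul n a == b].

Definition flow_circ (A : finZmodType) (mul : A -> A -> A) (n : nat) (a b : A) : A :=
  a + (expL mul n (Omega mul n a) (b, 0%:Z)).1.

(* Main.v *)
(* The operators L_a on A^id form a Lie ring g inside an associative ring in
   which products of n+1 of them vanish and 1, ..., n are invertible.  The heart
   of the matter is that exp(g) is closed under multiplication (the
   Baker-Campbell-Hausdorff theorem): with a formal variable t, the product
   G = exp(ta) exp(tb) solves G' = aG + Gb, and comparing it with
   exp(c)' = D exp(c), where D = sum_l ad_c^l(c')/(l+1)!, shows coefficient by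
   coefficient that G = exp(c) with c in g[t]; then put t = 1.
   Closure gives injectivity of W: if W(a) = W(b), then exp(-L_b) exp(L_a) =
   exp(L_c) fixes 1, and left nilpotency forces c = 0.  Since e^{L_Omega(a)}
   sends 1 + b to 1 + (a o b), closure also makes Omega turn the flow operation
   into composition of exponentials, whence associativity. *)
Require Import Defs.
From HB Require Import structures.
From mathcomp Require Import all_boot all_order all_algebra.
From mathcomp Require Import all_fingroup cyclic zify.
Set Implicit Arguments. Unset Strict Implicit. Unset Printing Implicit Defensive.
Import GRing.Theory.
Local Open Scope ring_scope.

(** * Additive subgroups *)

Definition subgroup (V : zmodType) (H : V -> Prop) :=
  H 0 /\ forall x y, H x -> H y -> H (x - y).

Lemma subgroupN {V : zmodType} {H : V -> Prop} {x} : subgroup H -> H x -> H (- x).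
Proof. by move=> [H0 HB] Hx; rewrite -sub0r; apply: HB. Qed.

Lemma subgroupD {V : zmodType} {H : V -> Prop} {x y} :
  subgroup H -> H x -> H y -> H (x + y).
Proof.
by move=> sH Hx Hy; rewrite -[y]opprK; apply: sH.2 => //; apply: subgroupN.
Qed.

Lemma subgroup_sum {V : zmodType} {H : V -> Prop} {I : Type} {r : seq I}
    {P : pred I} {F : I -> V} :
  subgroup H -> (forall i, P i -> H (F i)) -> H (\sum_(i <- r | P i) F i).
Proof.
by move=> sH HF; apply: big_ind => //; [exact: sH.1 | move=> x y; exact: subgroupD].
Qed.

Lemma subgroupMn {V : zmodType} {H : V -> Prop} {x} m :
  subgroup H -> H x -> H (x *+ m).
Proof.
move=> sH Hx; elim: m => [|m IH]; first by rewrite mulr0n; apply: sH.1.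
by rewrite mulrS; apply: subgroupD.
Qed.

(** * Brackets and truncated exponentials *)

(* [w j] is a natural number acting on R as 1/j!, so that subgroups of R are
   closed under division by j!. *)
Definition inv_fact (R : nzRingType) (n : nat) (w : nat -> nat) :=
  forall j, (j <= n)%N -> (j`! * w j)%:R = 1 :> R.

Definition bracket {R : nzRingType} (x y : R) := x * y - y * x.

Local Notation adn x l := (iter l (bracket x)).

Definition texp {R : nzRingType} (n : nat) (w : nat -> nat) (x : R) :=
  \sum_(j < n.+1) x ^+ j *+ w j.

(** Left multiplication by [x] is the sum of two commuting operators, the bracket with [x] and right
    multiplication by [x]; this is the binomial theorem for that sum. *)
Lemma exp_mul_ad (R : nzRingType) (x b : R) m :
  x ^+ m * b = \sum_(l < m.+1) adn x l b * x ^+ (m - l) *+ 'C(m, l).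
Proof.
elim: m => [|m IH]; first by rewrite big_ord1 /= mul1r mulr1.
rewrite exprS -mulrA IH mulr_sumr.
have E l : x * (adn x l b * x ^+ (m - l) *+ 'C(m, l)) =
    adn x l.+1 b * x ^+ (m - l) *+ 'C(m, l) +
    adn x l b * x ^+ (m - l).+1 *+ 'C(m, l).
  by rewrite iterS /bracket mulrnAr -mulrnDl exprS mulrBl !mulrA subrK.
under eq_bigr do rewrite E.
rewrite big_split /= [RHS]big_ord_recl /= bin0.
under [in RHS]eq_bigr do rewrite /bump /= add1n subSS binS mulrnDr.
rewrite big_split /= addrA [LHS]addrC; congr (_ + _).
rewrite big_ord_recl /= subn0 bin0; congr (_ + _).
rewrite big_ord_recr /= bin_small // mulr0n addr0.
by apply: eq_bigr => i _; rewrite /bump /= add1n subnSK.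
Qed.

(** In (x^m)' x + x^m x', the previous lemma moves x' to the left, and Pascal's rule adds up the
    coefficients. *)
Lemma deriv_exp_ad (R : nzRingType) (x : {poly R}) m :
  (x ^+ m)^`() = \sum_(l < m) adn x l x^`() * x ^+ (m - l.+1) *+ 'C(m, l.+1).
Proof.
elim: m => [|m IH]; first by rewrite big_ord0 expr0 -polyC1 derivC.
rewrite exprSr derivM IH exp_mul_ad mulr_suml addrC.
rewrite [RHS](eq_bigr (fun l : 'I_m.+1 => adn x l x^`() * x ^+ (m - l) *+ 'C(m, l)
   + adn x l x^`() * x ^+ (m - l) *+ 'C(m, l.+1))); last first.
  by move=> l _; rewrite subSS binS mulrnDr addrC.
rewrite big_split /=; congr (_ + _).
rewrite big_ord_recr /= bin_small // mulr0n addr0.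
by apply: eq_bigr => i _; rewrite mulrnAl -mulrA -exprSr subnSK.
Qed.

(** * Arithmetic of inverse factorials *)

Section InvFact.
Variables (R : nzRingType) (n : nat) (w : nat -> nat).
Hypothesis hw : inv_fact R n w.

Lemma inv_factE (x : R) j : (j <= n)%N -> x *+ (j`! * w j) = x.
Proof. by move=> jn; rewrite -mulr_natr hw // mulr1. Qed.

Lemma inv_fact_poly : inv_fact {poly R} n w.
Proof. by move=> j jn; rewrite -polyC_natr hw. Qed.

Lemma inv_fact0 (x : R) : x *+ w 0 = x.
Proof. by rewrite -[RHS](@inv_factE x 0) // mul1n. Qed.

Lemma inv_factS (x : R) j : (j < n)%N -> x *+ (w j.+1 * j.+1) = x *+ w j.
Proof.
(* Each side is first multiplied by a number that acts as 1, chosen so that the two multiples become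
   equal as natural numbers. *)
move=> jn; rewrite -[LHS](@inv_factE _ j (ltnW jn)) -[RHS](@inv_factE _ j.+1 jn).
by rewrite -!mulrnA factS; congr (_ *+ _); lia.
Qed.

Lemma inv_fact_bin (x : R) m l : (l <= m)%N -> (m <= n)%N ->
  x *+ (w m * 'C(m, l)) = x *+ (w l * w (m - l)).
Proof.
move=> lm mn.
rewrite -[LHS](@inv_factE _ l (leq_trans lm mn)).
rewrite -[LHS](@inv_factE _ (m - l) (leq_trans (leq_subr _ _) mn)).
rewrite -[RHS](@inv_factE _ m mn) -(bin_fact lm).
by rewrite -!mulrnA; congr (_ *+ _); lia.
Qed.
End InvFact.

(** * Coefficients of exponentials of polynomials *)

(** Divisibility by t^k, where t is the formal variable. *)
Definition vanishes {R : nzRingType} k (f : {poly R}) :=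
  forall i, (i < k)%N -> f`_i = 0.

Section Vanishing.
Variable R : nzRingType.
Implicit Types (f g c : {poly R}) (u v : nat -> {poly R}).

Lemma vanishes_le k l f : (k <= l)%N -> vanishes l f -> vanishes k f.
Proof. by move=> kl vf i ik; apply: vf; apply: leq_trans kl. Qed.

Lemma vanishesB k f g : vanishes k f -> vanishes k g -> vanishes k (f - g).
Proof. by move=> vf vg i ik; rewrite coefB vf // vg // subr0. Qed.

Lemma vanishesD k f g : vanishes k f -> vanishes k g -> vanishes k (f + g).
Proof. by move=> vf vg i ik; rewrite coefD vf // vg // addr0. Qed.

Lemma vanishesMn k f m : vanishes k f -> vanishes k (f *+ m).
Proof. by move=> vf i ik; rewrite coefMn vf // mul0rn. Qed.

Lemma vanishesM k l f g : vanishes k f -> vanishes l g -> vanishes (k + l) (f * g).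
Proof.
move=> vf vg i ik; rewrite coefM big1 // => -[j /=]; rewrite ltnS => ji _.
have [jk|kj] := ltnP j k; first by rewrite vf // mul0r.
by rewrite vg ?mulr0 //; lia.
Qed.

Lemma vanishesX c m : vanishes 1 c -> vanishes m (c ^+ m).
Proof.
by move=> vc; elim: m => [//|m IH]; rewrite exprS -add1n; apply: vanishesM.
Qed.

Lemma vanishes_ad c f m : vanishes 1 c -> vanishes m (adn c m f).
Proof.
move=> vc; elim: m => [//|m IH]; rewrite iterS /bracket.
by apply: vanishesB; [rewrite -add1n | rewrite -addn1]; apply: vanishesM.
Qed.

Lemma sum_triangle (V : zmodType) (F : nat -> nat -> V) m :
  \sum_(k < m) \sum_(l < k.+1) F l (k - l)%N = \sum_(l < m) \sum_(k < m - l) F l k.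
Proof.
elim: m => [|m IH]; first by rewrite !big_ord0.
rewrite big_ord_recr /= IH [RHS]big_ord_recr /= subSnn big_ord1.
rewrite [in LHS]big_ord_recr /= subnn addrA; congr (_ + _).
rewrite -big_split /=; apply: eq_bigr => l _.
by rewrite subSn ?big_ord_recr //= ltnW.
Qed.

(** Products [u l * v k] with l + k >= m1 are divisible by t^m1 and do not reach degree i; the
    others are regrouped by l + k. *)
Lemma coef_sum_mul_triangle u v m1 m2 i :
  (forall l, vanishes l (u l)) -> (forall l, vanishes l (v l)) ->
  (m1 <= m2)%N -> (i < m1)%N ->
  ((\sum_(l < m1) u l) * (\sum_(k < m2) v k))`_i =
  (\sum_(k < m1) \sum_(l < k.+1) u l * v (k - l)%N)`_i.
Proof.
move=> vu vv m12 im.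
rewrite (sum_triangle (fun l k => u l * v k)) mulr_suml !coef_sum.
apply: eq_bigr => -[l /= lm] _; rewrite mulr_sumr !coef_sum.
have -> : m2 = ((m1 - l) + (m2 - (m1 - l)))%N by lia.
rewrite big_split_ord /= [X in _ + X]big1 ?addr0 // => k _.
by apply: (@vanishesM l (m1 - l + k)) => //; lia.
Qed.
End Vanishing.

Lemma texp_recl (R : nzRingType) n w (x : R) : inv_fact R n w -> (0 < n)%N ->
  texp n w x = 1 + x + \sum_(j < n.-1) x ^+ j.+2 *+ w j.+2.
Proof.
case: n => [//|n] hw _; rewrite /texp !big_ord_recl expr0 (inv_fact0 hw) addrA.
suff E : x ^+ 1 *+ w 1 = x by congr (1 + _ + _).
by rewrite expr1 -[w 1]muln1 (inv_factS hw) // (inv_fact0 hw).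
Qed.

Section ExpPoly.
Variables (R : nzRingType) (n : nat) (w : nat -> nat).
Hypothesis hw : inv_fact R n w.
Let hwp := inv_fact_poly hw.

(** This is exp(c) b = exp(ad c)(b) exp(c) up to degree n: expand each c^m b and split C(m,l)/m!
    into 1/l! times 1/(m-l)!. *)
Lemma coef_texp_mul (c b : {poly R}) i : vanishes 1 c -> (i <= n)%N ->
  (texp n w c * b)`_i = ((\sum_(l < n.+1) adn c l b *+ w l) * texp n w c)`_i.
Proof.
move=> vc i_n; rewrite /texp (@coef_sum_mul_triangle _ (fun l => adn c l b *+ w l)
           (fun l => c ^+ l *+ w l)) //; first last.
- by move=> l; apply/vanishesMn/vanishesX.
- by move=> l; apply/vanishesMn/vanishes_ad.
rewrite mulr_suml; congr ((_ : {poly R})`_i).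
apply: eq_bigr => -[m /=]; rewrite ltnS => mn _.
rewrite mulrnAl exp_mul_ad -sumrMnl; apply: eq_bigr => -[l /=]; rewrite ltnS => lm _.
by rewrite mulrnAl mulrnAr -!mulrnA mulnC (inv_fact_bin hwp) // mulnC.
Qed.

(** This is exp(c)' = D exp(c) with D = sum_l ad_c^l(c')/(l+1)!. Differentiating the truncated sum
    loses one degree, hence i < n. *)
Lemma coef_deriv_texp (c : {poly R}) i : vanishes 1 c -> (i < n)%N ->
  (texp n w c)^`()`_i =
  ((\sum_(l < n) adn c l c^`() *+ w l.+1) * texp n w c)`_i.
Proof.
move=> vc i_n; rewrite /texp.
rewrite (@coef_sum_mul_triangle _ (fun l => adn c l c^`() *+ w l.+1)
           (fun l => c ^+ l *+ w l)) //; first last.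
- by move=> l; apply/vanishesMn/vanishesX.
- by move=> l; apply/vanishesMn/vanishes_ad.
rewrite raddf_sum big_ord_recl /= expr0 derivMn -polyC1 derivC mul0rn add0r.
congr ((_ : {poly R})`_i); apply: eq_bigr => -[m /= mn] _.
rewrite /bump add1n derivMn deriv_exp_ad -sumrMnl.
apply: eq_bigr => -[l /=]; rewrite ltnS => lm _.
by rewrite mulrnAl mulrnAr -!mulrnA mulnC (inv_fact_bin hwp) // mulnC subSS.
Qed.

Lemma texp_coef0 (c : {poly R}) : vanishes 1 c -> (texp n w c)`_0 = 1.
Proof.
move=> vc; rewrite /texp coef_sum big_ord_recl big1 ?addr0 /=.
  by rewrite (inv_fact0 hwp) coef1.
by move=> i _; rewrite (vanishesMn _ (vanishesX (m := bump 0 i) vc)).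
Qed.

(** Apart from [d] itself, every term that changes contains [d] and a further factor [c] or [d],
    which is divisible by t. So a correction of [c] acts additively on the first new coefficient. *)
Lemma vanishes_texpD (c d : {poly R}) k : (0 < n)%N -> (0 < k)%N ->
  vanishes 1 c -> vanishes k d -> vanishes k.+1 (texp n w (c + d) - texp n w c - d).
Proof.
move=> n0 k0 vc vd.
have vpow m : vanishes k.+1 ((c + d) ^+ m.+2 - c ^+ m.+2) /\
              vanishes k ((c + d) ^+ m.+1 - c ^+ m.+1).
  have vcd : vanishes 1 (c + d) by apply: vanishesD => //; apply: vanishes_le vd.
  have S j : vanishes k ((c + d) ^+ j.+1 - c ^+ j.+1) ->
      vanishes k.+1 ((c + d) ^+ j.+2 - c ^+ j.+2).
    move=> H; rewrite exprS [c ^+ j.+2]exprS.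
    have -> : (c + d) * (c + d) ^+ j.+1 - c * c ^+ j.+1 =
        (c + d) * ((c + d) ^+ j.+1 - c ^+ j.+1) + d * c ^+ j.+1.
      by rewrite mulrBr [(c + d) * c ^+ _]mulrDl opprD addrA subrK.
    apply: vanishesD; first by rewrite -add1n; apply: vanishesM.
    rewrite -addn1; apply: vanishesM => //.
    by apply: vanishes_le (vanishesX (m := j.+1) vc).
  elim: m => [|m [IH1 IH2]]; last first.
    by split; [apply: S; apply: vanishes_le IH1 | apply: vanishes_le IH1].
  suff V : vanishes k ((c + d) ^+ 1 - c ^+ 1) by split=> //; apply: S.
  by rewrite !expr1 addrC addKr.
have -> : texp n w (c + d) - texp n w c - d =
   \sum_(j < n.-1) ((c + d) ^+ j.+2 - c ^+ j.+2) *+ w j.+2.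
  rewrite !(texp_recl _ hwp) //; set S1 := \sum_(j < _) _; set S2 := \sum_(j < _) _.
  have -> : 1 + (c + d) + S1 - (1 + c + S2) - d = S1 - S2.
    have -> : 1 + (c + d) + S1 = (1 + c) + (d + S1) by rewrite !addrA.
    by rewrite opprD addrACA subrr add0r addrAC [d + S1]addrC addrK.
  by rewrite -sumrB; apply: eq_bigr => j _; rewrite -mulrnBl.
move=> i ik; rewrite coef_sum big1 // => j _.
by rewrite (vanishesMn _ (vpow j).1).
Qed.
End ExpPoly.

(** * Closure of exponentials under multiplication *)

(** The condition may vary with the degree: a constant [F] gives g[t], a filtration demands weight
    at least i of the coefficient of t^i. *)
Definition coefs_in {R : nzRingType} (F : nat -> R -> Prop) (f : {poly R}) :=
  forall i, F i f`_i.

Lemma subgroup_coefs_in (R : nzRingType) (F : nat -> R -> Prop) :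
  (forall i, subgroup (F i)) -> subgroup (coefs_in F).
Proof.
move=> sF; split=> [i|x y Fx Fy i]; first by rewrite coef0; apply: (sF i).1.
by rewrite coefB; apply: (sF i).2.
Qed.

Section Closure.
Variables (R : nzRingType) (n : nat) (w : nat -> nat).
Hypothesis hw : inv_fact R n w.
Let hwp := inv_fact_poly hw.
(** [Fil] is a decreasing multiplicative filtration that encodes nilpotency: [g] has weight 1, and
    weight n+1 is zero. *)
Variables (g : R -> Prop) (Fil : nat -> R -> Prop).
Hypothesis subgroup_g : subgroup g.
Hypothesis bracket_g : forall x y, g x -> g y -> g (bracket x y).
Hypothesis subgroup_Fil : forall i, subgroup (Fil i).
Hypothesis Fil1 : Fil 0 1.
Hypothesis FilM : forall i j x y, Fil i x -> Fil j y -> Fil (i + j) (x * y).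
Hypothesis Fil_le : forall i j x, (i <= j)%N -> Fil j x -> Fil i x.
Hypothesis g_Fil : forall x, g x -> Fil 1 x.
Hypothesis Fil_eq0 : forall x, Fil n.+1 x -> x = 0.

Local Notation gpoly := (coefs_in (fun=> g)).
Local Notation Fpoly := (coefs_in Fil).

Let subgroup_gpoly : subgroup gpoly := subgroup_coefs_in (fun=> subgroup_g).

Let bracket_gpoly x y : gpoly x -> gpoly y -> gpoly (bracket x y).
Proof.
(* Summing the second product in reverse order pairs its terms with those of the first into brackets
   of coefficients. *)
move=> gx gy i; rewrite /bracket coefB coefM coefMr -sumrB.
by apply: subgroup_sum => // j _; apply: bracket_g.
Qed.

Let adn_gpoly x y l : gpoly x -> gpoly y -> gpoly (adn x l y).
Proof. by move=> gx gy; elim: l => // l IH; apply: bracket_gpoly. Qed.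

Let subgroup_Fpoly : subgroup Fpoly := subgroup_coefs_in subgroup_Fil.

Let FpolyM x y : Fpoly x -> Fpoly y -> Fpoly (x * y).
Proof.
move=> gx gy i; rewrite coefM; apply: subgroup_sum => // -[j /=]; rewrite ltnS => ji _.
by rewrite -{1}(subnKC ji); apply: FilM.
Qed.

Let Fpoly_texp x : Fpoly x -> Fpoly (texp n w x).
Proof.
move=> Fx; rewrite /texp; apply: (subgroup_sum subgroup_Fpoly) => j _.
apply: (subgroupMn _ subgroup_Fpoly).
elim: {j}(j : nat) => [|j IH]; last by rewrite exprS; apply: FpolyM.
rewrite expr0 => -[|i]; rewrite coef1 //; exact: (subgroup_Fil _).1.
Qed.

Let Fpoly_eq0 f i : Fpoly f -> (n < i)%N -> f`_i = 0.
Proof. by move=> Ff ni; apply: Fil_eq0; apply: Fil_le ni _. Qed.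

Let Fil_exp x i : g x -> Fil i (x ^+ i).
Proof.
move=> gx; elim: i => [|i IH]; first by rewrite expr0.
by rewrite exprS -add1n; apply: FilM => //; apply: g_Fil.
Qed.

(** The polynomial exp(ta) in t. *)
Let flow (a : R) := \poly_(i < n.+1) (a ^+ i *+ w i).

Let flow1 a : (flow a).[1] = texp n w a.
Proof. by rewrite horner_poly; apply: eq_bigr => i _; rewrite expr1n mulr1. Qed.

Let Fpoly_flow a : g a -> Fpoly (flow a).
Proof.
move=> ga i; rewrite coef_poly; case: ifP => _; last exact: (subgroup_Fil _).1.
by apply: subgroupMn => //; apply: Fil_exp.
Qed.

Let deriv_flow a : g a -> (flow a)^`() = a%:P * flow a.
Proof.
move=> ga; apply/polyP => i; rewrite coef_deriv coefCM !coef_poly ltnS.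
case: ltngtP => [i_n|ni|->].
- by rewrite ltnS ltnW // -mulrnA (inv_factS hw) // exprS mulrnAr.
- by rewrite ltnS leqNgt ni mul0rn mulr0.
(* In the top degree the derivative has no term, and a^(n+1) vanishes by weight. *)
- by rewrite mul0rn ltnS leqnn mulrnAr -exprS (Fil_eq0 (Fil_exp _ ga)) mul0rn.
Qed.

Let flow_comm a : flow a * a%:P = a%:P * flow a.
Proof.
apply/polyP => i; rewrite coefMC coefCM coef_poly; case: ifP => _.
  by rewrite mulrnAl mulrnAr -exprS -exprSr.
by rewrite mul0r mulr0.
Qed.

Let flow_coef0 a : (flow a)`_0 = 1.
Proof. by rewrite coef_poly /= expr0 (inv_fact0 hw). Qed.

(* If exp(c) agrees with G up to degree k, comparing the derivatives of G and
   exp(c) in degree k shows that k+1 times the next error term is a coefficient of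
   a + exp(ad c)(b) - D, where exp(c)' = D exp(c); this is a combination of
   brackets. *)
Let log_exists (a b : R) (G : {poly R}) k :
  g a -> g b -> Fpoly G -> G`_0 = 1 ->
  (forall i, (i < n)%N -> G`_i.+1 *+ i.+1 = a * G`_i + G`_i * b) ->
  (k <= n)%N ->
  exists c, [/\ gpoly c, Fpoly c, vanishes 1 c &
                forall i, (i <= k)%N -> (texp n w c)`_i = G`_i].
Proof.
move=> ga gb FG G0 dG; elim: k => [_|k IH kn].
  exists 0; split; [exact: subgroup_gpoly.1 | exact: subgroup_Fpoly.1 | |].
    by move=> i _; rewrite coef0.
  move=> i; rewrite leqn0 => /eqP ->; rewrite G0 (texp_coef0 hw) // => j _.
  by rewrite coef0.
have [c [gc Fc vc Ec]] := IH (ltnW kn).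
pose E := texp n w c; pose d := G`_k.+1 - E`_k.+1.
have Fd : Fil k.+1 d by apply: (subgroup_Fil _).2 => //; apply: Fpoly_texp.
(* This is a + exp(ad c)(b) - D, so that f E = aE + Eb - E' below degree n. *)
pose f := a%:P + (\sum_(l < n.+1) adn c l b%:P *+ w l)
          - \sum_(l < n) adn c l c^`() *+ w l.+1.
have gC x : g x -> gpoly x%:P.
  by move=> gx i; rewrite coefC; case: eqP => // _; apply: subgroup_g.1.
have gf : gpoly f.
  have gdc : gpoly c^`() by move=> i; rewrite coef_deriv; apply: subgroupMn.
  apply: (subgroup_gpoly.2); last first.
    apply: (subgroup_sum subgroup_gpoly) => l _.
    by apply: (subgroupMn _ subgroup_gpoly); apply: adn_gpoly.
  apply: (subgroupD subgroup_gpoly); first exact: gC.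
  apply: (subgroup_sum subgroup_gpoly) => l _; apply: (subgroupMn _ subgroup_gpoly).
  by apply: adn_gpoly => //; apply: gC.
have fE i : (i < n)%N -> (f * E)`_i = a * E`_i + E`_i * b - E`_i.+1 *+ i.+1.
  move=> i_n; rewrite mulrBl mulrDl coefB coefD coefCM.
  rewrite -(coef_texp_mul hw) ?(ltnW i_n) // coefMC.
  by rewrite -(coef_deriv_texp hw) // coef_deriv.
have E0 : E`_0 = 1 by apply: (texp_coef0 hw).
(* Below degree k the product f E is zero because E agrees with G up to degree k; as E has constant
   term 1, f vanishes there degree by degree. *)
have f0 : vanishes k f.
  move=> i; elim/ltn_ind: i => i IHi ik.
  have := fE i (ltn_trans ik kn); rewrite !Ec ?(ltnW ik) // -dG ?(ltn_trans ik) //.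
  rewrite subrr coefM big_ord_recr /= subnn E0 mulr1 big1 ?add0r // => -[j /= ji] _.
  by rewrite IHi ?mul0r // (ltn_trans ji).
have fk : f`_k = d *+ k.+1.
  have := fE k kn; rewrite Ec // -dG // -mulrnBl => <-.
  rewrite coefM big_ord_recr /= subnn E0 mulr1 big1 ?add0r // => -[j /= ji] _.
  by rewrite f0 ?mul0r.
have gd : g d.
  rewrite -(inv_factE hw d kn) factS -mulnA mulrnA -fk.
  by apply: subgroupMn.
(* Adding d t^(k+1) to c repairs degree k+1 and leaves the lower degrees untouched. *)
pose D := d *: 'X^(k.+1).
have DE i : D`_i = if i == k.+1 then d else 0.
  by rewrite coefZ coefXn; case: eqP => _; rewrite ?mulr1 ?mulr0.
have vD : vanishes k.+1 D by move=> i ik; rewrite DE ltn_eqF.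
exists (c + D); split.
- apply: (subgroupD subgroup_gpoly) => // i; rewrite DE.
  by case: eqP => // _; apply: subgroup_g.1.
- apply: (subgroupD subgroup_Fpoly) => // i; rewrite DE.
  by case: eqP => [->//|_]; apply: (subgroup_Fil _).1.
- by apply: vanishesD => //; apply: vanishes_le vD.
have texpD i : (i <= k.+1)%N -> (texp n w (c + D))`_i = E`_i + D`_i.
  move=> ik; apply/eqP; rewrite [E`_i + _]addrC -subr_eq -subr_eq0 -!coefB; apply/eqP.
  exact: (vanishes_texpD hw (leq_trans (ltn0Sn k) kn) (ltn0Sn k) vc vD).
move=> i; rewrite leq_eqVlt ltnS => /orP[/eqP->|ik].
  by rewrite texpD // DE eqxx addrC subrK.
by rewrite texpD ?(leqW ik) // vD // addr0 Ec.
Qed.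

Lemma texp_mul_closed (a b : R) : g a -> g b ->
  exists2 c, g c & texp n w c = texp n w a * texp n w b.
Proof.
move=> ga gb; pose G := flow a * flow b.
have FG : Fpoly G by apply: FpolyM; apply: Fpoly_flow.
have G0 : G`_0 = 1 by rewrite coefM big_ord1 /= !flow_coef0 mulr1.
have dG i : (i < n)%N -> G`_i.+1 *+ i.+1 = a * G`_i + G`_i * b.
  move=> _; rewrite -coef_deriv derivM !deriv_flow // -[b%:P * _]flow_comm.
  by rewrite mulrA -mulrA -/G coefD coefCM coefMC.
have [c [gc Fc vc Ec]] := log_exists ga gb FG G0 dG (leqnn n).
(* Above degree n the coefficients on both sides have weight at least n+1 and vanish. *)
have EG : texp n w c = G.
  apply/polyP => i; have [/Ec//|ni] := leqP i n.
  by rewrite !Fpoly_eq0 //; apply: Fpoly_texp.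
(* Evaluation at t = 1 is multiplicative because 1 is central. *)
exists c.[1].
  by rewrite horner_coef; apply: subgroup_sum => // i _; rewrite expr1n mulr1.
rewrite -[texp n w a]flow1 -[texp n w b]flow1 -hornerM_comm -/G -?EG; last first.
  by rewrite /comm_poly mul1r mulr1.
rewrite /texp horner_sum; apply: eq_bigr => j _.
by rewrite hornerMn horner_exp_comm // /comm_poly mul1r mulr1.
Qed.

(** The polynomial exp(-ta) exp(ta) has derivative 0 and constant term 1. Since 1, ..., n are
    invertible and degrees above n vanish by weight, it equals 1. *)
Lemma texpN_mul (a : R) : g a -> texp n w (- a) * texp n w a = 1.
Proof.
move=> ga; have gNa : g (- a) by apply: subgroupN.
pose G := flow (- a) * flow a.
have FG : Fpoly G by apply: FpolyM; apply: Fpoly_flow.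
have flowN_comm : flow (- a) * a%:P = a%:P * flow (- a).
  by have := flow_comm (- a); rewrite polyCN mulrN mulNr => /oppr_inj.
have dG : G^`() = 0.
  rewrite derivM !deriv_flow // polyCN mulNr mulNr -flowN_comm mulrA.
  by rewrite addrC subrr.
rewrite -!flow1 -hornerM_comm -/G; last by rewrite /comm_poly mul1r mulr1.
suff -> : G = 1 by rewrite hornerC.
apply/polyP => -[|i]; first by rewrite coefM big_ord1 /= !flow_coef0 mulr1 coef1.
rewrite coef1; have [ni|i_n] := leqP n i; first by rewrite Fpoly_eq0.
have := congr1 (fun f : {poly R} => f`_i) dG; rewrite /= coef_deriv coef0 => Gi.
by rewrite -(inv_factE hw G`_i.+1 i_n) factS -mulnA mulrnA Gi mul0rn.
Qed.

(** Equal exponentials make x - y a combination of differences of higher powers, which lie at least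
    one weight deeper than x - y; iterating reaches weight n+1. *)
Lemma texp_inj (x y : R) : Fil 1 x -> Fil 1 y -> texp n w x = texp n w y -> x = y.
Proof.
move=> Fx Fy Exy.
have Fpow m : Fil m (y ^+ m).
  elim: m => [|m IH]; first by rewrite expr0.
  by rewrite exprS -add1n; apply: FilM.
have FsubX k m : Fil k (x - y) -> Fil (k + m) (x ^+ m.+1 - y ^+ m.+1).
  move=> Fd; elim: m => [|m IH]; first by rewrite !expr1 addn0.
  have -> : x ^+ m.+2 - y ^+ m.+2 =
      x * (x ^+ m.+1 - y ^+ m.+1) + (x - y) * y ^+ m.+1.
    by rewrite mulrBr mulrBl -!exprS addrA subrK.
  by apply: subgroupD => //; [rewrite addnS -add1n | ]; apply: FilM.
suff FB k : Fil k.+1 (x - y) by apply/subr0_eq/Fil_eq0.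
elim: k => [|k IH]; first exact: (subgroup_Fil _).2.
case: (posnP n) => [n0|n0].
  have H z : Fil 1 z -> z = 0 by move=> Fz; apply: Fil_eq0; rewrite n0.
  by rewrite (H x) // (H y) // subrr; apply: (subgroup_Fil _).1.
move: Exy; rewrite !(texp_recl _ hw) //.
set X := \sum_(j < _) _; set Y := \sum_(j < _) _ => Exy.
have -> : x - y = Y - X.
  apply/eqP; rewrite subr_eq addrAC eq_sym subr_eq; apply/eqP/(addrI 1).
  by rewrite !addrA Exy addrAC.
rewrite -sumrB; apply: subgroup_sum => // j _; rewrite -mulrnBl.
apply: subgroupMn => //; rewrite -opprB; apply: subgroupN => //.
by apply: Fil_le (FsubX _ j.+1 IH); rewrite addnS ltnS leq_addr.
Qed.
End Closure.

(** * The endomorphism ring of A x Z/(r+2) *)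

(** Finite functions with a boolean condition make [endo] a subtype, with extensional equality and
    an inherited choice structure. *)
Definition additiveb (B : finZmodType) (f : {ffun B -> B}) :=
  [forall x, forall y, f (x + y) == f x + f y].

(* The factor Z of A^id is replaced by Z/(r+2), with (r+2)A = 0, so that j!
   becomes invertible (in the application r+2 = p^(n+1)); the quotient is nontrivial even if A = 0, so that 1 <> 0 in
   the endomorphism ring, as required for polynomials over it. *)
Definition ext (A : finZmodType) (r : nat) := (A * 'I_r.+2)%type.
HB.instance Definition _ A r := GRing.Zmodule.on (ext A r).
HB.instance Definition _ A r := Finite.on (ext A r).

Record endo (A : finZmodType) (r : nat) :=
  Endo { endo_fun :> {ffun ext A r -> ext A r}; endo_additive : additiveb endo_fun }.

Section Endo.
Variables (A : finZmodType) (r : nat).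
Local Notation B := (ext A r).
Local Notation E := (endo A r).

HB.instance Definition _ := [isSub for @endo_fun A r].
HB.instance Definition _ := [Choice of E by <:].

Implicit Types f g h : E.

Lemma endoD f x y : f (x + y) = f x + f y.
Proof. by have /forallP/(_ x)/forallP/(_ y)/eqP := endo_additive f. Qed.

Lemma endo_eq f g : (forall x, f x = g x) -> f = g.
Proof. by move=> fg; apply/val_inj/ffunP. Qed.

Fact additiveb_ffun (F : B -> B) :
  (forall x y, F (x + y) = F x + F y) -> additiveb [ffun x => F x].
Proof. by move=> FD; apply/forallP => x; apply/forallP => y; rewrite !ffunE FD. Qed.

Definition endo_of F FD : E := Endo (@additiveb_ffun F FD).

Lemma endo_ofE F FD x : @endo_of F FD x = F x.
Proof. by rewrite ffunE. Qed.

Fact endo0_subproof (x y : B) : (fun=> 0 : B) (x + y) = 0 + 0.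
Proof. by rewrite addr0. Qed.
Fact endo_opp_subproof f (x y : B) : - f (x + y) = - f x + - f y.
Proof. by rewrite endoD opprD. Qed.
Fact endo_add_subproof f g (x y : B) : f (x + y) + g (x + y) = f x + g x + (f y + g y).
Proof. by rewrite !endoD addrACA. Qed.
Fact endo_mul_subproof f g (x y : B) : f (g (x + y)) = f (g x) + f (g y).
Proof. by rewrite !endoD. Qed.

Definition endo_zero := endo_of endo0_subproof.
Definition endo_opp f := endo_of (endo_opp_subproof f).
Definition endo_add f g := endo_of (endo_add_subproof f g).
Definition endo_one : E := @endo_of id (fun x y => erefl).
Definition endo_mul f g := endo_of (endo_mul_subproof f g).

Fact endo_addA : associative endo_add.
Proof. by move=> f g h; apply: endo_eq => x; rewrite !endo_ofE addrA. Qed.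
Fact endo_addC : commutative endo_add.
Proof. by move=> f g; apply: endo_eq => x; rewrite !endo_ofE addrC. Qed.
Fact endo_add0 : left_id endo_zero endo_add.
Proof. by move=> f; apply: endo_eq => x; rewrite !endo_ofE add0r. Qed.
Fact endo_addN : left_inverse endo_zero endo_opp endo_add.
Proof. by move=> f; apply: endo_eq => x; rewrite !endo_ofE addNr. Qed.

HB.instance Definition _ :=
  GRing.isZmodule.Build E endo_addA endo_addC endo_add0 endo_addN.

Fact endo_mulA : associative endo_mul.
Proof. by move=> f g h; apply: endo_eq => x; rewrite !endo_ofE. Qed.
Fact endo_mul1 : left_id endo_one endo_mul.
Proof. by move=> f; apply: endo_eq => x; rewrite !endo_ofE. Qed.
Fact endo_1mul : right_id endo_one endo_mul.
Proof. by move=> f; apply: endo_eq => x; rewrite !endo_ofE. Qed.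
Fact endo_mulDl : left_distributive endo_mul +%R.
Proof. by move=> f g h; apply: endo_eq => x; rewrite !endo_ofE. Qed.
Fact endo_mulDr : right_distributive endo_mul +%R.
Proof. by move=> f g h; apply: endo_eq => x; rewrite !endo_ofE endoD. Qed.
Fact endo_one_neq0 : endo_one != 0.
Proof.
apply/eqP => /(congr1 (fun f : E => (f (0, 1)).2)); rewrite /= !ffunE.
by move=> H; have /eqP[] := oner_neq0 'I_r.+2; exact: H.
Qed.

HB.instance Definition _ := GRing.Zmodule_isNzRing.Build E
  endo_mulA endo_mul1 endo_1mul endo_mulDl endo_mulDr endo_one_neq0.

Lemma endoDE f g x : (f + g) x = f x + g x. Proof. exact: endo_ofE. Qed.
Lemma endoNE f x : (- f) x = - f x. Proof. exact: endo_ofE. Qed.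
Lemma endoME f g x : (f * g) x = f (g x). Proof. exact: endo_ofE. Qed.
Lemma endo0E x : (0 : E) x = 0. Proof. exact: endo_ofE. Qed.
Lemma endo1E x : (1 : E) x = x. Proof. exact: endo_ofE. Qed.

Lemma endoMnE f m x : (f *+ m) x = f x *+ m.
Proof. by elim: m => [|m IH]; rewrite ?mulr0n ?endo0E // !mulrS endoDE IH. Qed.

Lemma endoXE f m x : (f ^+ m) x = iter m f x.
Proof. by elim: m => [|m IH]; rewrite ?endo1E // exprS endoME IH. Qed.

Lemma endo_sumE (I : Type) (s : seq I) (P : pred I) (F : I -> E) x :
  (\sum_(i <- s | P i) F i) x = \sum_(i <- s | P i) F i x.
Proof. by elim/big_rec2: _ => [|i y f _ <-]; rewrite ?endo0E ?endoDE. Qed.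
End Endo.

(** * The group of flows *)

Lemma subgroup_add_gen (V : zmodType) (S : V -> Prop) : subgroup (add_gen S).
Proof.
split=> [H H0 _ _ //|x y Sx Sy H H0 HB HS].
by apply: (HB); [exact: Sx | exact: Sy].
Qed.

Lemma add_gen_min (V : zmodType) (S H : V -> Prop) x :
  subgroup H -> (forall y, S y -> H y) -> add_gen S x -> H x.
Proof. by move=> [H0 HB] SH; apply. Qed.

Lemma subgroup_lpow (V : zmodType) (op : V -> V -> V) i : subgroup (lpow op i).
Proof. by case: i => [|i]; [split | apply: subgroup_add_gen]. Qed.

Lemma lpow_op (V : zmodType) (op : V -> V -> V) i a b :
  lpow op i b -> lpow op i.+1 (op a b).
Proof. by move=> ib H _ _ HS; apply: HS; exists a, b. Qed.

(** By induction, the generators on the left stay inside the left powers on the right. This serves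
    to compare the brace with the pre-Lie ring. *)
Lemma lpow_sub (V : zmodType) (op1 op2 : V -> V -> V) i :
  (forall j a b, lpow op2 j b -> lpow op2 j.+1 (op1 a b)) ->
  forall x, lpow op1 i x -> lpow op2 i x.
Proof.
move=> H12; elim: i => [//|i IH] x /=; apply: add_gen_min.
  exact: (subgroup_lpow _ i.+1).
by move=> _ [a [b [/IH ib ->]]]; apply: H12.
Qed.

Lemma lpow_le (V : zmodType) (op : V -> V -> V) i j x :
  (i <= j)%N -> lpow op j x -> lpow op i x.
Proof.
have S k y : lpow op k.+1 y -> lpow op k y.
  elim: k y => [//|k IH] y; apply: add_gen_min; first exact: subgroup_lpow.
  by move=> _ [a [b [/IH kb ->]]]; apply: lpow_op.
by move=> /subnKC <-; elim: (j - i)%N => [|k IH]; rewrite ?addn0 // addnS => /S.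
Qed.

Section Flow.
Variables (A : finZmodType) (mul : A -> A -> A) (n r : nat) (w : nat -> nat).
Hypothesis preLie : is_preLie_ring mul.
Hypothesis char_A : forall x : A, x *+ r.+2 = 0.
Hypothesis hw : forall j, (j <= n)%N -> (j`! * w j = 1 %[mod r.+2])%N.
(** With indices shifted by one, this says A^(n+1) = 0. *)
Hypothesis lpow_eq0 : forall x, lpow mul n x -> x = 0.
Local Notation B := (ext A r).
Local Notation E := (endo A r).

Let mulDl x y z : mul (x + y) z = mul x z + mul y z.
Proof. by case: preLie. Qed.
Let mulDr x y z : mul x (y + z) = mul x y + mul x z.
Proof. by case: preLie. Qed.
Let mulBl x y z : mul (x - y) z = mul x z - mul y z.
Proof. by apply/eqP; rewrite eq_sym subr_eq -mulDl subrK. Qed.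
Let mulr_0 z : mul z 0 = 0.
Proof. by apply: (addrI (mul z 0)); rewrite -mulDr !addr0. Qed.

Let mulrMn x y m : mul x (y *+ m) = mul x y *+ m.
Proof. by elim: m => [|m IH]; rewrite ?mulr0n ?mulr_0 // !mulrS mulDr IH. Qed.

Let mulrn_mod (x : A) m : x *+ (m %% r.+2) = x *+ m.
Proof.
by rewrite [in RHS](divn_eq m r.+2) mulrnDr mulnC mulrnA char_A mul0rn add0r.
Qed.

Let hwA (x : A) j : (j <= n)%N -> x *+ (j`! * w j) = x.
Proof. by move=> /hw E1; rewrite -mulrn_mod E1 mulrn_mod. Qed.

Let hwE : inv_fact E n w.
Proof.
move=> j jn; apply: endo_eq => -[x k]; rewrite endoMnE endo1E.
have pairMn m : ((x, k) : B) *+ m = (x *+ m, k *+ m).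
  by elim: m => [|m IH]; rewrite ?mulr0n // !mulrS IH.
rewrite pairMn hwA //; congr (_, _).
rewrite -mulr_natr; suff -> : (j`! * w j)%:R = 1 :> 'I_r.+2 by rewrite mulr1.
by rewrite Zp_nat; apply: val_inj; rewrite /= hw.
Qed.

(** * Left multiplications and the filtration by left powers *)

Fact left_mul_subproof (a : A) (x y : B) :
  ((mul a (x + y).1 + a *+ (x + y).2, 0) : B) =
  (mul a x.1 + a *+ x.2, 0) + (mul a y.1 + a *+ y.2, 0).
Proof.
case: x y => [x k] [y l] /=; congr (_, _); last by rewrite /= addr0.
(* The second components add modulo r+2, which is harmless because (r+2)A = 0. *)
by rewrite mulrn_mod mulDr mulrnDr addrACA.
Qed.

Definition left_mul (a : A) : E := endo_of (left_mul_subproof a).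

Local Notation L := left_mul.

Lemma left_mulE a (x : B) : L a x = (mul a x.1 + a *+ x.2, 0).
Proof. exact: endo_ofE. Qed.

Definition is_left_mul (f : E) := exists a, f = L a.

Lemma left_mulB a b : L a - L b = L (a - b).
Proof.
apply: endo_eq => x; rewrite endoDE endoNE !left_mulE; congr (_, _) => /=.
  by rewrite mulBl mulrnBl opprD addrACA.
by rewrite subr0.
Qed.

(** On A this is the pre-Lie identity; on the unit both sides give ab - ba. *)
Lemma left_mul_bracket a b : bracket (L a) (L b) = L (mul a b - mul b a).
Proof.
apply: endo_eq => -[x k]; rewrite /bracket endoDE endoNE !endoME !left_mulE.
congr (_, _) => /=; last by rewrite subr0.
rewrite !mulr0n !addr0 mulBl mulrnBl !mulDr !mulrMn opprD addrACA; congr (_ + _).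
case: preLie => _ _ /(_ a b x)/eqP; rewrite subr_eq => /eqP ->.
by rewrite [_ - _ + _]addrAC -addrA addrAC subrr add0r addrC.
Qed.

Lemma subgroup_is_left_mul : subgroup is_left_mul.
Proof.
split=> [|_ _ [a ->] [b ->]]; last by exists (a - b); rewrite left_mulB.
by exists 0; rewrite -[in RHS](subrr 0) -left_mulB subrr.
Qed.

(** Weight 0 is the whole extension, and weight j >= 1 is A^j x {0}. *)
Definition ext_pow (j : nat) (x : B) : Prop :=
  if j is j'.+1 then lpow mul j' x.1 /\ x.2 = 0 else True.

Lemma subgroup_ext_pow j : subgroup (ext_pow j).
Proof.
case: j => [|j]; first by [].
split=> [|x y [x1 x2] [y1 y2]]; first by split => //; apply: (subgroup_lpow _ _).1.
by split; [apply: (subgroup_lpow _ _).2 | rewrite /= x2 y2 subr0].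
Qed.

Lemma ext_pow_le i j x : (i <= j)%N -> ext_pow j x -> ext_pow i x.
Proof.
case: i j => [|i] [|j] //; rewrite ltnS => ij [x1 x2]; split=> //.
exact: lpow_le x1.
Qed.

Definition endo_fil (i : nat) (f : E) :=
  forall j x, ext_pow j x -> ext_pow (i + j) (f x).

Lemma endo_fil_eq0 f : endo_fil n.+1 f -> f = 0.
Proof.
move=> Ff; apply: endo_eq => x; have := Ff 0%N x I; rewrite endo0E addn0.
by case: (f x) => [y k] [/= /lpow_eq0 -> ->].
Qed.

Lemma endo_fil_left_mul a : endo_fil 1 (L a).
Proof.
move=> [|j] x; rewrite left_mulE //; case=> [x1 x2]; split=> //=.
by rewrite x2 mulr0n addr0; apply: lpow_op.
Qed.

Lemma subgroup_endo_fil i : subgroup (endo_fil i).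
Proof.
split=> [j x _|f g Ff Fg j x jx]; first by rewrite endo0E; apply: (subgroup_ext_pow _).1.
by rewrite endoDE endoNE; apply: (subgroup_ext_pow _).2; [apply: Ff | apply: Fg].
Qed.

Lemma endo_fil1 : endo_fil 0 1.
Proof. by move=> j x; rewrite endo1E. Qed.

Lemma endo_filM i j f g : endo_fil i f -> endo_fil j g -> endo_fil (i + j) (f * g).
Proof.
by move=> Ff Fg k x kx; rewrite endoME -addnA; apply: Ff; apply: Fg.
Qed.

Lemma endo_fil_le i j f : (i <= j)%N -> endo_fil j f -> endo_fil i f.
Proof.
by move=> ij Ff k x kx; apply: ext_pow_le (Ff k x kx); rewrite leq_add2r.
Qed.

(** * Exponentials of left multiplications *)

Definition expm a : E := texp n w (L a).

Let bracket_left_mul f h : is_left_mul f -> is_left_mul h -> is_left_mul (bracket f h).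
Proof.
by move=> [a ->] [b ->]; rewrite left_mul_bracket; exists (mul a b - mul b a).
Qed.

Let endo_fil_is_left_mul f : is_left_mul f -> endo_fil 1 f.
Proof. by move=> [a ->]; apply: endo_fil_left_mul. Qed.

Let is_left_mulL a : is_left_mul (L a). Proof. by exists a. Qed.

Lemma expm_mul a b : exists c, expm c = expm a * expm b.
Proof.
have [c [d ->] E1] := texp_mul_closed hwE subgroup_is_left_mul bracket_left_mul
  subgroup_endo_fil endo_fil1 endo_filM endo_fil_le endo_fil_is_left_mul
  endo_fil_eq0 (is_left_mulL a) (is_left_mulL b).
by exists d.
Qed.

Lemma left_mul0 : L 0 = 0.
Proof. by rewrite -(subrr (L 0)) left_mulB subrr. Qed.

Lemma expmN_mul a : expm (- a) * expm a = 1.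
Proof.
rewrite /expm -[- a]sub0r -left_mulB left_mul0 sub0r.
exact: (texpN_mul hwE subgroup_is_left_mul subgroup_endo_fil endo_fil1 endo_filM
  endo_fil_le endo_fil_is_left_mul endo_fil_eq0 (is_left_mulL a)).
Qed.

Local Notation e := ((0, 1) : B).

Lemma left_mul_e a : L a e = (a, 0).
Proof. by rewrite left_mulE /= mulr_0 add0r. Qed.

Lemma expm_inj : injective expm.
Proof.
move=> a b /(texp_inj hwE subgroup_endo_fil endo_fil1 endo_filM endo_fil_le
  endo_fil_eq0 (endo_fil_left_mul a) (endo_fil_left_mul b)).
by move/(congr1 (fun f : E => (f e).1)); rewrite !left_mul_e.
Qed.

Lemma endo_fil_exp a i : endo_fil i (L a ^+ i).
Proof.
elim: i => [|i IH]; first by rewrite expr0; apply: endo_fil1.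
by rewrite exprS -add1n; apply: endo_filM => //; apply: endo_fil_left_mul.
Qed.

(** Without its constant term 1, the exponential only contains positive powers of L_a, each of
    weight at least 1. *)
Lemma expm_sub_ext_pow j a (x : B) : ext_pow j x -> ext_pow j.+1 (expm a x - x).
Proof.
suff F1 : endo_fil 1 (expm a - 1).
  by move=> /F1; rewrite endoDE endoNE endo1E.
rewrite /expm /texp big_ord_recl /= (inv_fact0 hwE) expr0 addrC addKr.
apply: (subgroup_sum (subgroup_endo_fil 1)) => i _.
apply: (subgroupMn _ (subgroup_endo_fil 1)).
by apply: endo_fil_le (endo_fil_exp _ _); rewrite /bump.
Qed.

Lemma expm2 a x : (expm a x).2 = x.2.
Proof. by have [_ /subr0_eq] := @expm_sub_ext_pow 0 a x I. Qed.

Lemma expm0 : expm 0 = 1.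
Proof.
rewrite /expm left_mul0 /texp big_ord_recl big1 => [|i _].
  by rewrite addr0 expr0 (inv_fact0 hwE).
by rewrite expr0n mul0rn.
Qed.

(** If exp(L_c) fixes 1, then c is minus a sum of multiples of L_c^(i+1)(c), which lie deeper in the
    left powers than c; iterating puts c in A^(n+1) = 0. *)
Lemma expm_fix_e c : expm c e = e -> c = 0.
Proof.
move=> Ec; apply: lpow_eq0; case: (posnP n) => [->//|n0].
have S j : lpow mul j c -> lpow mul j.+1 c.
  move=> jc; suff /= [] : ext_pow j.+2 ((c, 0) : B) by [].
  have : expm c e = e + ((c, 0) + \sum_(i < n.-1) (L c ^+ i.+2 *+ w i.+2) e).
    by rewrite /expm (texp_recl _ hwE) // !endoDE endo1E endo_sumE left_mul_e addrA.
  rewrite Ec => /eqP; rewrite -subr_eq0 opprD addrA subrr add0r oppr_eq0.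
  rewrite addr_eq0 => /eqP ->.
  apply: (subgroupN (subgroup_ext_pow _)).
  apply: (subgroup_sum (subgroup_ext_pow _)) => i _; rewrite endoMnE.
  apply: (subgroupMn _ (subgroup_ext_pow _)).
  rewrite exprSr endoME left_mul_e.
  apply: ext_pow_le (@endo_fil_exp c i.+1 j.+1 (c, 0) (conj jc erefl)).
  by rewrite addSn ltnS leq_addl.
by elim: n => [//|m IH]; apply: S.
Qed.

(** * Comparison with the exponential over the integers *)

Lemma divA_fact j (x : A) : (j <= n)%N -> divA j`! x = x *+ w j.
Proof.
move=> jn; rewrite /divA; case: pickP => [y /eqP <-|/(_ (x *+ w j))] /=.
  by rewrite -mulrnA hwA.
by rewrite -mulrnA mulnC hwA // eqxx.
Qed.

(** After one application of L_a the extra component is 0 on both sides, so the integer and its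
    residue matter only in the first step. *)
Lemma expLE a (x : A * int) (y : B) : x.1 = y.1 -> x.2 = (y.2 : nat) ->
  (expL mul n a x).1 = (expm a y).1.
Proof.
move=> xy1 xy2.
have iterE j : (iter j (Lid mul a) x).1 = (iter j (L a) y).1 /\
               (iter j (Lid mul a) x).2 = ((iter j (L a) y).2 : nat).
  elim: j => [//|j [IH1 IH2]]; rewrite !iterS left_mulE /Lid /idmul /=.
  by rewrite IH1 IH2 mulr0z addr0 mul0r.
have fst_sum (V W : zmodType) (I : Type) (s : seq I) (F : I -> V * W) :
    (\sum_(i <- s) F i).1 = \sum_(i <- s) (F i).1.
  by elim/big_rec2: _ => [//|i y1 y2 _ <-].
have -> : expm a y = y + \sum_(1 <= j < n.+1) (iter j (L a) y *+ w j).
  rewrite /expm /texp endo_sumE big_ord_recl expr0 (inv_fact0 hwE) endo1E.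
  rewrite big_add1 big_mkord; congr (_ + _); apply: eq_bigr => i _.
  by rewrite endoMnE endoXE.
rewrite /expL /= xy1 !fst_sum; congr (_ + _).
apply: eq_big_nat => j /andP[_ jn] /=; rewrite (iterE j).1 divA_fact //.
by elim: (w j) => [|m IH]; rewrite ?mulr0n // !mulrS /= IH.
Qed.

(** * The bijection W and its inverse *)

Local Notation W := (Wmap mul n).

Lemma expm_e a : expm a e = (W a, 1).
Proof.
rewrite [LHS]surjective_pairing expm2; congr (_, _).
have -> : W a = (expL mul n a (0, 1%:Z)).1 - 0 by [].
by rewrite subr0 (@expLE a _ e).
Qed.

Lemma Wmap_inj : injective W.
Proof.
move=> a b Wab; have [c Ec] := expm_mul (- b) a.
have c0 : c = 0.
  apply: expm_fix_e; rewrite Ec endoME expm_e Wab -expm_e -endoME expmN_mul.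
  exact: endo1E.
(* Here exp(L_a) = exp(L_b) exp(-L_b) exp(L_a) = exp(L_b) exp(L_c) with c = 0. *)
apply: expm_inj; rewrite -[LHS]mul1r -(expmN_mul (- b)) opprK -mulrA -Ec c0 expm0.
by rewrite mulr1.
Qed.

Local Notation Om := (Omega mul n).

Lemma OmegaK a : W (Om a) = a.
Proof.
rewrite /Omega; case: pickP => [x /eqP //|/= H].
(* An injective self-map of a finite set is bijective, so the default value of [Omega] is never
   taken. *)
by have [V _ WV] := injF_bij Wmap_inj; have := H (V a); rewrite WV eqxx.
Qed.

Lemma WmapK a : Om (W a) = a.
Proof. by apply: Wmap_inj; rewrite OmegaK. Qed.

(** * The brace of flows *)

Local Notation circ := (flow_circ mul n).

Lemma flow_circE a b : circ a b = a + (expm (Om a) (b, 0)).1.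
Proof. by rewrite /flow_circ (@expLE (Om a) (b, 0%:Z) (b, 0)). Qed.

Lemma expm_Omega a b : expm (Om a) (b, 1) = (circ a b, 1).
Proof.
have -> : ((b, 1) : B) = e + (b, 0) by congr (_, _); rewrite /= ?add0r ?addr0.
rewrite endoD expm_e OmegaK [expm _ (b, 0)]surjective_pairing expm2.
by rewrite flow_circE; congr (_, _); rewrite addr0.
Qed.

(** Closure writes the product as exp(L_c); its value at 1 shows W(c) = a o b, so c is Omega(a o
    b). *)
Lemma expm_circ a b : expm (Om (circ a b)) = expm (Om a) * expm (Om b).
Proof.
have [c Ec] := expm_mul (Om a) (Om b).
have Wc : W c = circ a b.
  have := expm_e c; rewrite Ec endoME expm_e OmegaK expm_Omega.
  by move=> [].
by rewrite -Ec -Wc WmapK.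
Qed.

Lemma flow_circ_brace : is_left_brace circ.
Proof.
have pair1_inj x y : (x, 1) = (y, 1) :> B -> x = y by case.
have W0 : W 0 = 0 by apply: pair1_inj; rewrite -expm_e expm0 endo1E.
have Om0 : Om 0 = 0 by rewrite -W0 WmapK.
split; last first.
  move=> a b c; rewrite !flow_circE.
  have -> : ((b + c, 0) : B) = (b, 0) + (c, 0) by congr (_, _); rewrite addr0.
  by rewrite endoD /= -addrA addrACA addrA addrAC.
split=> [a b c|].
  (* Both bracketings come from applying exp(L_Omega(a)) exp(L_Omega(b)) to (c, 1). *)
  apply: pair1_inj; rewrite -!expm_Omega expm_circ endoME.
  by rewrite !expm_Omega.
exists 0; split=> [b|].
  by apply: pair1_inj; rewrite -expm_Omega Om0 expm0 endo1E.
split=> [a|a].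
  by apply: pair1_inj; rewrite -expm_Omega expm_e OmegaK.
(* The inverse comes from exp(-L_Omega(a)). *)
exists (W (- Om a)); split; apply: pair1_inj; rewrite -expm_Omega.
  by rewrite -expm_e -endoME -{1}[Om a]opprK expmN_mul endo1E.
by rewrite WmapK -{2}[a]OmegaK -expm_e -endoME expmN_mul endo1E.
Qed.

(** Since a * b = exp(L_Omega(a))(b) - b lies one left power deeper than b, the left powers of the
    brace are contained in those of the pre-Lie ring. *)
Lemma brace_star_nilpotent : left_nilpotent (brace_star circ).
Proof.
exists n => x xn; apply: lpow_eq0; move: x xn; apply: lpow_sub => j a b jb.
have [] := @expm_sub_ext_pow j.+1 (Om a) (b, 0) (conj jb erefl).
by rewrite /brace_star flow_circE [a + _]addrC addrK.
Qed.
End Flow.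

(** * Vanishing of A^(n+1) *)

(* The left powers as elements of {group A}, to which Lagrange's theorem applies. *)
Fixpoint gpow (A : finZmodType) (mul : A -> A -> A) (i : nat) : {group A} :=
  if i is j.+1 then <<[set mul a b | a in [set: A], b in gpow mul j]>>%G
  else [group of [set: A]].

Lemma gpowP (A : finZmodType) (mul : A -> A -> A) i x :
  lpow mul i x <-> x \in gpow mul i.
Proof.
elim: i x => [|i IH] x; first by rewrite inE.
(* In a finite group the generated subgroup consists of products of generators, here sums. *)
split=> [|/gen_prodgP[m [c cP ->]]].
  apply: (@add_gen_min _ _ (fun y => y \in gpow mul i.+1)); last first.
    move=> _ [a [b [/IH ib ->]]].
    by apply/mem_gen/imset2P; exists a b; rewrite ?inE.
  split=> [|y z Hy Hz]; first exact: (group1 (gpow mul i.+1)).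
  by rewrite -FinRing.zmodVgE -FinRing.zmodMgE groupM // groupV.
apply: big_ind => [|y z|k _].
- exact: (subgroup_lpow mul i.+1).1.
- exact: (subgroupD (subgroup_lpow mul i.+1)).
by have /imset2P[a b _ /IH ib ->] := cP k; apply: lpow_op.
Qed.

(* Each left power is a proper subgroup of the previous one until they vanish,
   so the index of each inclusion is at least p. *)
Lemma lpow_card_eq0 (A : finZmodType) (mul : A -> A -> A) (p n : nat) :
  left_nilpotent mul -> prime p -> #|A| = (p ^ n)%N ->
  forall x, lpow mul n x -> x = 0.
Proof.
move=> [m lpow_m] p_pr cardA.
pose S := gpow mul.
have S_le i j : (i <= j)%N -> S j \subset S i.
  by move=> ij; apply/subsetP => x /gpowP jx; apply/gpowP/(lpow_le ij).
have Sm1 : S m :=: 1%g.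
  by apply/trivgP/subsetP => x /gpowP/lpow_m ->; rewrite inE.
(* Once two consecutive left powers agree, all later ones do, and a late one is trivial. *)
have S_stable i : S i.+1 :=: S i -> S i :=: 1%g.
  move=> Si; have Sik k : S (i + k)%N :=: S i.
    elim: k => [|k IH]; first by rewrite addn0.
    by rewrite addnS -Si /S /= -/S IH.
  by apply/trivgP; rewrite -(Sik m) -Sm1 S_le ?leq_addl.
have cardS i : S i :!=: 1%g -> (#|S i| * p ^ i <= p ^ n)%N.
  elim: i => [|i IH] Si1; first by rewrite muln1 cardsT cardA.
  have Sprev : S i :!=: 1%g.
    apply: contraNneq Si1 => E1; rewrite -subG1 -E1; exact: S_le.
  apply: leq_trans (IH Sprev); rewrite expnS mulnA leq_mul2r; apply/orP; right.
  rewrite -(Lagrange (S_le _ _ (leqnSn i))) leq_mul2l; apply/orP; right.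
  (* The index is a power of p; exponent 0 would make consecutive left powers equal, hence
     trivial. *)
  have : (#|S i : S i.+1|%g %| p ^ n)%N.
    by rewrite -cardA -cardsT; apply: dvdn_trans (dvdn_indexg _ _) (cardSg (subsetT _)).
  case/(dvdn_pfactor _ _ p_pr) => -[|e] _ iE; last first.
    by rewrite iE expnS leq_pmulr // expn_gt0 prime_gt0.
  case/eqP: Sprev; apply: S_stable; apply/eqP; rewrite eqEsubset S_le //=.
  by rewrite -indexg_eq1 iE.
have Sn1 : S n :=: 1%g.
  apply/eqP/negPn/negP => Sn; have := cardS n Sn.
  rewrite -[leqRHS]mul1n leq_pmul2r ?expn_gt0 ?prime_gt0 // leqNgt.
  by rewrite cardG_gt1 Sn.
by move=> x /gpowP; rewrite -/S Sn1 => /set1P.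
Qed.

(** * Choice of the modulus and conclusion *)

Theorem theorem9 (A : finZmodType) (mul : A -> A -> A) (p n : nat) :
  is_preLie_ring mul ->
  left_nilpotent mul ->
  prime p ->
  (n.+2 <= p)%N ->
  #|A| = (p ^ n)%N ->
  is_left_brace (flow_circ mul n) /\
  left_nilpotent (brace_star (flow_circ mul n)).
Proof.
move=> preLie nilA p_pr np cardA.
have q1 : (1 < p ^ n.+1)%N.
  by rewrite (leq_trans (prime_gt1 p_pr)) // expnS leq_pmulr // expn_gt0 prime_gt0.
(* The exponent n+1 makes the modulus at least 2 also for n = 0, and it still annihilates A. *)
set r := (p ^ n.+1).-2; have rE : r.+2 = (p ^ n.+1)%N by rewrite /r; lia.
have char_A (x : A) : x *+ r.+2 = 0.
  have xA : x *+ #|A| = 0.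
    by rewrite -FinRing.zmodXgE -cardsT (@expg_cardG _ [group of [set: A]]) ?inE.
  by rewrite rE expnSr mulrnA -cardA xA mul0rn.
(* A Bezout coefficient inverts j! modulo p^(n+1), because all factors of j! are smaller than p. *)
pose w j := (egcdn j`! r.+2).1.
have hw j : (j <= n)%N -> (j`! * w j = 1 %[mod r.+2])%N.
  move=> jn; have cop : coprime j`! r.+2.
    rewrite rE coprimeXr // coprime_sym prime_coprime //.
    elim: j jn => [_|j IH jn]; first by rewrite dvdn1 neq_ltn prime_gt1 ?orbT.
    rewrite factS Euclid_dvdM // negb_or IH ?(ltnW jn) // andbT gtnNdvd //.
    by apply: leq_trans np; apply: leqW.
  rewrite /w; case: egcdnP => [|u v /= E1 _]; first exact: fact_gt0.
  by rewrite mulnC E1 (eqP cop) modnMDl.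
have lpow0 := lpow_card_eq0 nilA p_pr cardA.
split; first exact: (flow_circ_brace preLie char_A hw lpow0).
exact: (brace_star_nilpotent preLie char_A hw lpow0).
Qed.
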